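(* Let $X$, $Y$ be complex Banach spaces and let $\Phi: X\to Y$ be a linear map (not assumed bounded) with dense range. Let $T: X\to X$ be a linear operator (not assumed bounded) and let $S\in B(Y)$ be a generalized scalar operator, and suppose that $\Phi T = S\Phi$. Then $\sigma(S)\subset \overline{\sigma(T)}$.
   Context: $B(Y)$ is the algebra of bounded linear operators on $Y$. A bounded operator $S$ on a Banach space $Y$ is called generalized scalar if there is a unital continuous homomorphism $f\mapsto f(S)$ from $C^\infty(\mathbb{R}^2)$ (complex-valued smooth functions with the usual Fréchet topology) to $B(Y)$ satisfying $z(S)=S$, where $z(x,y)=x+iy$. For a linear operator $T$ defined on all of $X$, $\sigma(T)$ is the set of $\lambda\in\mathbb{C}$ such that $T-\lambda 1: X\to X$ is not bijective (for bounded $T$ this is the usual spectrum); $\overline{\sigma(T)}$ is its closure in $\mathbb{C}$. *)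

(* Defs.v *)
From HB Require Import structures.
From mathcomp Require Import all_boot all_order all_algebra.
From mathcomp Require Import all_classical all_reals all_analysis.
From mathcomp.real_closed Require Import complex.
From mathcomp Require Import ring.

Set Implicit Arguments.
Unset Strict Implicit.
Unset Printing Implicit Defensive.

Import Order.TTheory GRing.Theory Num.Theory.
Import numFieldNormedType.Exports.

Local Open Scope classical_set_scope.
Local Open Scope ring_scope.
Local Open Scope complex_scope.

(* The modulus topology on [R[i]]; the library only provides it on [R[i]^o]. *)
HB.instance Definition _ (R : rcfType) := NormedModule.copy R[i] R[i]^o.

Section SmoothFunctions.
Variable R : realType.
Implicit Types (f g : R * R -> R[i]) (b : bool) (s : seq bool) (p : R * R).

(* [false] stands for the variable x, [true] for the variable y. *)
Definition axis b : R * R := if b then (0, 1) else (1, 0).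

Definition partial b f : R * R -> R[i] := fun p =>
  'D_(axis b) (fun q => complex.Re (f q)) p +i*
  'D_(axis b) (fun q => complex.Im (f q)) p.

Definition has_partial b f := forall p,
  derivable (fun q => complex.Re (f q)) p (axis b) /\
  derivable (fun q => complex.Im (f q)) p (axis b).

Definition partials s f := foldr partial f s.

(* [partials s] runs over all iterated partial derivatives, in every order of
   differentiation; smoothness asks that all of them exist and are continuous. *)
Definition smooth f := forall s,
  continuous (partials s f) /\ forall b, has_partial b (partials s f).

Definition coord_z : R * R -> R[i] := fun p => p.1 +i* p.2.

(* Auxiliary: stable under sums, products and [partial], hence included in
   [smooth], which makes the smooth functions a subalgebra. *)
Inductive smooth_alg : (R * R -> R[i]) -> Prop :=
| smooth_alg_smooth f : smooth f -> smooth_alg f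
| smooth_alg_cst c : smooth_alg (cst c)
| smooth_alg_z : smooth_alg coord_z
| smooth_algD f g : smooth_alg f -> smooth_alg g -> smooth_alg (f + g)
| smooth_algM f g : smooth_alg f -> smooth_alg g -> smooth_alg (f * g).

Lemma smooth_partial b f : smooth f -> smooth (partial b f).
Proof. by move=> sf s; rewrite /partials -foldr_rcons; exact: sf. Qed.

Lemma has_partial_cst b c : has_partial b (cst c).
Proof. by move=> p; split; exact: derivable_cst. Qed.

Lemma partial_cst b c : partial b (cst c) = cst 0.
Proof.
by apply/funext => p; rewrite /partial /= !derive_cst.
Qed.

Let is_derive_linear (L : R * R -> R) p v :
  (forall h, L (h *: v + p) = h * L v + L p) -> is_derive p v L (L v).
Proof.
move=> hL.
have cv : (fun h => h^-1 *: (L (h *: v + p) - L p)) @ (0 : R)^' --> L v.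
  apply: cvg_near_cst; near=> h.
  rewrite hL addrK scalerA mulVf ?scale1r //.
  by near: h; exact: nbhs_dnbhs_neq.
by apply: DeriveDef; [apply/cvg_ex; exists (L v)|exact: cvg_lim].
Unshelve. all: by end_near. Qed.

Let is_derive_fst p v : is_derive p v (fun q : R * R => q.1) v.1.
Proof. exact: is_derive_linear. Qed.

Let is_derive_snd p v : is_derive p v (fun q : R * R => q.2) v.2.
Proof. exact: is_derive_linear. Qed.

Lemma has_partial_z b : has_partial b coord_z.
Proof. by move=> p; split; apply: ex_derive. Qed.

Lemma partial_z b : partial b coord_z = cst ((axis b).1 +i* (axis b).2).
Proof.
apply/funext => p; rewrite /partial /=; congr (_ +i* _); exact: derive_val.
Qed.

Let normc_le (a b : R) : `|a +i* b| <= (`|a| + `|b|)%:C.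
Proof.
have -> : a +i* b = a%:C + 'i%C * b%:C by simpc.
rewrite (le_trans (ler_normD _ _)) // rmorphD normrM !normc_def /= .
by rewrite !expr0n !expr1n !(addr0, add0r) sqrtr1 mul1r !sqrtr_sqr.
Qed.

Lemma continuous_z : continuous coord_z.
Proof.
move=> p; apply/cvgrPdist_lt => e e0.
have eE : e = (complex.Re e)%:C by rewrite RRe_real // gtr0_real.
have e20 : 0 < complex.Re e / 2 by rewrite divr_gt0 // -ltcR -eE.
near=> q.
have -> : coord_z p - coord_z q = (p.1 - q.1) +i* (p.2 - q.2) by [].
rewrite (le_lt_trans (normc_le _ _)) // eE ltcR [ltRHS]splitr ltrD //; near: q.
- exact: (@cvgr_dist_lt _ _ _ _ _ fst _ cvg_fst).
- exact: (@cvgr_dist_lt _ _ _ _ _ snd _ cvg_snd).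
Unshelve. all: by end_near. Qed.

Let ReD f g : (fun q => complex.Re ((f + g) q)) =
  (fun q => complex.Re (f q)) + (fun q => complex.Re (g q)).
Proof. by apply/funext => q; rewrite !fctE; case: (f q); case: (g q). Qed.

Let ImD f g : (fun q => complex.Im ((f + g) q)) =
  (fun q => complex.Im (f q)) + (fun q => complex.Im (g q)).
Proof. by apply/funext => q; rewrite !fctE; case: (f q); case: (g q). Qed.

Let ReM f g : (fun q => complex.Re ((f * g) q)) =
  (fun q => complex.Re (f q)) * (fun q => complex.Re (g q)) -
  (fun q => complex.Im (f q)) * (fun q => complex.Im (g q)).
Proof. by apply/funext => q; rewrite !fctE; case: (f q); case: (g q). Qed.

Let ImM f g : (fun q => complex.Im ((f * g) q)) =
  (fun q => complex.Re (f q)) * (fun q => complex.Im (g q)) +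
  (fun q => complex.Im (f q)) * (fun q => complex.Re (g q)).
Proof. by apply/funext => q; rewrite !fctE; case: (f q); case: (g q). Qed.

Let dD (u v : R * R -> R) p d : derivable u p d -> derivable v p d ->
  derivable (u + v) p d /\ 'D_d (u + v) p = 'D_d u p + 'D_d v p.
Proof. by move=> du dv; split; [exact: derivableD|exact: deriveD]. Qed.

Let dB (u v : R * R -> R) p d : derivable u p d -> derivable v p d ->
  derivable (u - v) p d /\ 'D_d (u - v) p = 'D_d u p - 'D_d v p.
Proof. by move=> du dv; split; [exact: derivableB|exact: deriveB]. Qed.

Let dM (u v : R * R -> R) p d : derivable u p d -> derivable v p d ->
  derivable (u * v) p d /\ 'D_d (u * v) p = u p * 'D_d v p + v p * 'D_d u p.
Proof. by move=> du dv; split; [exact: (derivableM du dv)|rewrite (deriveM du dv)]. Qed.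

Lemma has_partialD b f g :
  has_partial b f -> has_partial b g -> has_partial b (f + g).
Proof.
move=> hf hg p; have [f1 f2] := hf p; have [g1 g2] := hg p.
by rewrite ReD ImD; split; [case: (dD f1 g1)|case: (dD f2 g2)].
Qed.

Lemma partialD b f g : has_partial b f -> has_partial b g ->
  partial b (f + g) = partial b f + partial b g.
Proof.
move=> hf hg; apply/funext => p; have [f1 f2] := hf p; have [g1 g2] := hg p.
by rewrite /partial ReD ImD (dD f1 g1).2 (dD f2 g2).2.
Qed.

Lemma has_partialM b f g :
  has_partial b f -> has_partial b g -> has_partial b (f * g).
Proof.
move=> hf hg p; have [f1 f2] := hf p; have [g1 g2] := hg p.
rewrite ReM ImM; split.
- by case: (dB (dM f1 g1).1 (dM f2 g2).1).
- by case: (dD (dM f1 g2).1 (dM f2 g1).1).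
Qed.

Lemma partialM b f g : has_partial b f -> has_partial b g ->
  partial b (f * g) = partial b f * g + f * partial b g.
Proof.
move=> hf hg; apply/funext => p; have [f1 f2] := hf p; have [g1 g2] := hg p.
rewrite /partial ReM ImM (dB (dM f1 g1).1 (dM f2 g2).1).2.
rewrite (dD (dM f1 g2).1 (dM f2 g1).1).2.
rewrite (dM f1 g1).2 (dM f2 g2).2 (dM f1 g2).2 (dM f2 g1).2 !fctE.
move: ('D_ _ _ _) ('D_ _ _ _) ('D_ _ _ _) ('D_ _ _ _) => d1 d2 d3 d4.
case: (f p) (g p) => a a' [c c'] /=.
by congr (_ +i* _); rewrite /= ; ring.
Qed.

Lemma smooth_alg_step f : smooth_alg f -> [/\ continuous f,
  forall b, has_partial b f & forall b, smooth_alg (partial b f)].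
Proof.
elim=> {f} [f sf|c||f g _ [cf pf af] _ [cg pg ag]|f g sf [cf pf af] sg [cg pg ag]].
- split; [exact: (sf [::]).1|exact: (sf [::]).2|move=> b].
  by apply: smooth_alg_smooth; exact: smooth_partial.
- split; [by move=> x; exact: cvg_cst|by move=> b; exact: has_partial_cst|].
  by move=> b; rewrite partial_cst; exact: smooth_alg_cst.
- split; [exact: continuous_z|exact: has_partial_z|].
  by move=> b; rewrite partial_z; exact: smooth_alg_cst.
- split=> [x|b|b]; [exact: (cvgD (cf x) (cg x))|exact: has_partialD|].
  by rewrite partialD //; exact: smooth_algD.
- split=> [x|b|b]; [exact: (cvgM (cf x) (cg x))|exact: has_partialM|].
  rewrite (partialM (pf b) (pg b)).
  exact: (smooth_algD (smooth_algM (af b) sg) (smooth_algM sf (ag b))).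
Qed.

Lemma smooth_alg_is_smooth f : smooth_alg f -> smooth f.
Proof.
move=> af s; suff /smooth_alg_step[] : smooth_alg (partials s f) by [].
by elim: s => //= b s /smooth_alg_step[].
Qed.

End SmoothFunctions.

Section Cinfty.
Variable R : realType.

Definition smoothb : {pred R * R -> R[i]} := fun f => `[< smooth f >].

Record Cinfty := MkCinfty {
  Cinfty_fun :> R * R -> R[i];
  _ : Cinfty_fun \in smoothb
}.

HB.instance Definition _ := [isSub for Cinfty_fun].
HB.instance Definition _ := [Choice of Cinfty by <:].

Let smoothbP f : f \in smoothb <-> smooth_alg f.
Proof.
split=> [/asboolP/smooth_alg_smooth //|af].
by apply/asboolP; exact: smooth_alg_is_smooth.
Qed.

Lemma smoothb_subring : subring_closed smoothb.
Proof.
split=> [|f g|f g].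
- by apply/smoothbP; exact: smooth_alg_cst.
- move=> /smoothbP sf /smoothbP sg; apply/smoothbP.
  rewrite (_ : f - g = f + cst (-1) * g); last first.
    by apply/funext => x; rewrite !fctE mulN1r.
  apply: smooth_algD => //; apply: smooth_algM => //; exact: smooth_alg_cst.
- move=> /smoothbP sf /smoothbP sg; apply/smoothbP; exact: smooth_algM.
Qed.

Lemma smoothb_scale : scaler_closed smoothb.
Proof.
move=> c f /smoothbP sf; apply/smoothbP.
rewrite (_ : c *: f = cst c * f); last by apply/funext.
by apply: smooth_algM => //; exact: smooth_alg_cst.
Qed.

HB.instance Definition _ := GRing.isSubringClosed.Build _ smoothb smoothb_subring.
HB.instance Definition _ := GRing.isScaleClosed.Build _ _ smoothb smoothb_scale.
HB.instance Definition _ := [SubChoice_isSubComNzRing of Cinfty by <:].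
HB.instance Definition _ := [SubZmodule_isSubLmodule of Cinfty by <:].

Let Cinfty_scalerAl (k : R[i]) (f g : Cinfty) : k *: (f * g) = (k *: f) * g.
Proof. by apply/val_inj/funext => p; exact: mulrA. Qed.

HB.instance Definition _ := GRing.Lmodule_isLalgebra.Build _ Cinfty Cinfty_scalerAl.
HB.instance Definition _ := GRing.Lalgebra_isComAlgebra.Build _ Cinfty.

Lemma Cinfty_smooth (f : Cinfty) : smooth f.
Proof. by case: f => f sf; exact/asboolP. Qed.

Lemma coord_z_smooth : @coord_z R \in smoothb.
Proof. by apply/smoothbP; exact: smooth_alg_z. Qed.

Definition Cinfty_z : Cinfty := MkCinfty coord_z_smooth.

(* The ball of radius [e] around [f] for the seminorm
   [h |-> max_(size s <= n) sup_(|p| <= n) |partials s h p|]. The supremum over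
   the compact set [|p| <= n] is attained, so the strict bound can be required
   pointwise. These balls define the Frechet topology. *)
Definition Cinfty_ball (f : Cinfty) (n : nat) (e : R) : set Cinfty :=
  [set g : Cinfty | forall s p, (size s <= n)%N -> `|p| <= n%:R ->
    `|partials s (g - f : Cinfty) p| < e%:C].

Definition Cinfty_nbhs (f : Cinfty) : set_system Cinfty :=
  filter_from [set ne : nat * R | 0 < ne.2] (fun ne => Cinfty_ball f ne.1 ne.2).

HB.instance Definition _ := hasNbhs.Build Cinfty Cinfty_nbhs.

Let partials_add s (f g : Cinfty) :
  partials s (f + g : Cinfty) = partials s f + partials s g.
Proof.
elim: s => //= b s ->; apply: partialD; exact: (Cinfty_smooth _ s).2.
Qed.

Let partials0 s : partials s (0 : Cinfty) = 0.
Proof.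
by have := partials_add s 0 0; rewrite addr0 => /eqP; rewrite addrC -subr_eq subrr => /eqP.
Qed.

Let ball_center (f : Cinfty) n e : 0 < e -> Cinfty_ball f n e f.
Proof. by move=> e0 s p _ _; rewrite subrr partials0 normr0 ltcR. Qed.

Let ball_triangle (f g h : Cinfty) n e d :
  Cinfty_ball f n e g -> Cinfty_ball g n d h -> Cinfty_ball f n (e + d) h.
Proof.
move=> fg gh s p sn pn; rewrite -(subrKA g) addrC partials_add.
by rewrite (le_lt_trans (ler_normD _ _)) // rmorphD ltrD ?fg ?gh.
Qed.

Let ball_mono (f : Cinfty) n m e d : (m <= n)%N -> e <= d ->
  Cinfty_ball f n e `<=` Cinfty_ball f m d.
Proof.
move=> mn ed g fg s p sm pm; apply: (@lt_le_trans _ _ e%:C); last by rewrite lecR.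
by apply: fg; [exact: leq_trans sm mn|rewrite (le_trans pm) // ler_nat].
Qed.

Let nbhs_filter (f : Cinfty) : ProperFilter (nbhs f).
Proof.
apply: filter_from_proper; last first.
  by move=> [n e] e0; exists f; exact: ball_center.
apply: filter_from_filter; first by exists (0%N, 1) => /=.
move=> [n e] [m d] /= e0 d0; exists (maxn n m, Num.min e d) => /=.
  by rewrite lt_min e0.
move=> g fg; split; apply: ball_mono fg; rewrite ?leq_maxl ?leq_maxr //.
  by rewrite ge_min lexx.
by rewrite ge_min lexx orbT.
Qed.

Let nbhs_singleton (f : Cinfty) (A : set Cinfty) : nbhs f A -> A f.
Proof. by move=> [[n e] e0]; apply; exact: ball_center. Qed.

Let nbhs_nbhs (f : Cinfty) (A : set Cinfty) : nbhs f A -> nbhs f (nbhs^~ A).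
Proof.
move=> [[n e] /= e0 sA]; exists (n, e / 2); first by rewrite /= divr_gt0.
move=> g fg; exists (n, e / 2); first by rewrite /= divr_gt0.
by move=> h gh; apply: sA; rewrite [e]splitr; exact: ball_triangle fg gh.
Qed.

HB.instance Definition _ :=
  Nbhs_isNbhsTopological.Build Cinfty nbhs_filter nbhs_singleton nbhs_nbhs.

End Cinfty.

Section BoundedOperators.
Variables (R : realType) (Y : normedModType R[i]).

Definition bounded_linear : {pred Y -> Y} :=
  fun f => `[< linear f /\ exists M : R, forall y, `|f y| <= M%:C * `|y| >].

Record boundedOp := MkBoundedOp {
  boundedOp_fun :> Y -> Y;
  _ : boundedOp_fun \in bounded_linear
}.

HB.instance Definition _ := [isSub for boundedOp_fun].
HB.instance Definition _ := [Choice of boundedOp by <:].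

Lemma bounded_linearP (f : Y -> Y) :
  reflect (linear f /\ continuous f) (f \in bounded_linear).
Proof.
rewrite unfold_in; apply: (iffP (asboolP _)) => -[lf bf]; split=> //.
- pose g : {linear Y -> Y} := HB.pack f (GRing.isLinear.Build _ _ _ _ f lf).
  apply: (@bounded_linear_continuous _ _ _ g); apply/linear_boundedP.
  case: bf => M fM; near=> r => y; rewrite (le_trans (fM y)) // ler_wpM2r //.
  by near: r; apply: nbhs_pinfty_ge; by rewrite complex_real.
- pose g : {linear Y -> Y} := HB.pack f (GRing.isLinear.Build _ _ _ _ f lf).
  have /linear_boundedP/pinfty_ex_gt0[M M0 fM] : bounded_near g (nbhs (0 : Y)).
    by apply/continuous_linear_bounded; exact: bf.
  by exists (complex.Re M) => y; rewrite RRe_real ?gtr0_real //; exact: fM.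
Unshelve. all: by end_near. Qed.

Lemma bounded_linear_submod : submod_closed bounded_linear.
Proof.
split=> [|k f g /bounded_linearP[lf cf] /bounded_linearP[lg cg]];
  apply/bounded_linearP.
  by split=> [k x y|x]; [rewrite /= scaler0 addr0|exact: cvg_cst].
split=> [a x y|x].
  rewrite !fctE lf lg !scalerDr !scalerA [k * a]mulrC -!addrA; congr (_ + _).
  by rewrite addrCA.
by apply: cvgD; [exact: cvgZl_tmp (cf x)|exact: cg].
Qed.

HB.instance Definition _ :=
  GRing.isSubmodClosed.Build _ _ bounded_linear bounded_linear_submod.
HB.instance Definition _ := [SubChoice_isSubLmodule of boundedOp by <:].

Lemma boundedOp_linear (A : boundedOp) : linear A.
Proof. by case: A => f hf; have /bounded_linearP[] := hf. Qed.

Lemma boundedOp_continuous (A : boundedOp) : continuous A.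
Proof. by case: A => f hf; have /bounded_linearP[] := hf. Qed.

HB.instance Definition _ (A : boundedOp) :=
  GRing.isLinear.Build _ _ _ _ A (boundedOp_linear A).

Lemma bounded_linear_id : idfun \in bounded_linear.
Proof. by apply/bounded_linearP; split=> // x; exact: cvg_id. Qed.

Lemma bounded_linear_comp (A B : boundedOp) : A \o B \in bounded_linear.
Proof.
apply/bounded_linearP; split=> [k x y|x] /=; first by rewrite !linearP.
by apply: continuous_comp; exact: boundedOp_continuous.
Qed.

Definition idOp : boundedOp := MkBoundedOp bounded_linear_id.
Definition compOp (A B : boundedOp) : boundedOp :=
  MkBoundedOp (bounded_linear_comp A B).

Let compOpA : associative compOp. Proof. by move=> *; exact: val_inj. Qed.
Let comp1Op : left_id idOp compOp. Proof. by move=> *; exact: val_inj. Qed.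
Let compOp1 : right_id idOp compOp. Proof. by move=> *; exact: val_inj. Qed.
Let compOpDl : left_distributive compOp +%R.
Proof. by move=> *; exact: val_inj. Qed.
Let compOpDr : right_distributive compOp +%R.
Proof. by move=> A B C; apply/val_inj/funext => y /=; exact: linearD. Qed.

(* [B(Y)] is a possibly trivial ring, as [Y] may be the zero space. *)
HB.instance Definition _ := GRing.Zmodule_isPzRing.Build boundedOp
  compOpA comp1Op compOp1 compOpDl compOpDr.

Definition opnorm (A : boundedOp) : R :=
  sup [set complex.Re `|A y| | y in [set y | `|y| <= 1]].

Let ReK (r : R[i]) : 0 <= r -> (complex.Re r)%:C = r.
Proof. by move=> r0; rewrite RRe_real // ger0_real. Qed.

Let opnorm_has_sup (A : boundedOp) :
  has_sup [set complex.Re `|A y| | y in [set y | `|y| <= 1]].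
Proof.
split; first by exists (complex.Re `|A 0|), 0 => //=; rewrite normr0.
have /linear_boundedP/pinfty_ex_gt0[M M0 hM] : bounded_near A (nbhs (0 : Y)).
  by apply/continuous_linear_bounded/boundedOp_continuous.
exists (complex.Re M) => _ [y /= y1 <-].
rewrite -lecR !ReK ?(ltW M0) // (le_trans (hM y)) //.
by rewrite -[leRHS]mulr1 ler_wpM2l // ltW.
Qed.

Lemma opnorm_ge0 (A : boundedOp) : 0 <= opnorm A.
Proof.
apply: (@le_trans _ _ (complex.Re `|A 0|)); first by rewrite linear0 normr0.
by apply: ub_le_sup; [exact: (opnorm_has_sup A).2|exists 0; rewrite /= ?normr0].
Qed.

Lemma opnormP (A : boundedOp) y : `|A y| <= (opnorm A)%:C * `|y|.
Proof.
have [->|y0] := eqVneq y 0; first by rewrite linear0 !normr0 mulr0.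
have ny : 0 < `|y| by rewrite normr_gt0.
have : complex.Re `|A (`|y|^-1 *: y)| <= opnorm A.
  apply: ub_le_sup; first exact: (opnorm_has_sup A).2.
  by exists (`|y|^-1 *: y) => //=; rewrite normfZV.
rewrite -lecR ReK // linearZ /= normrZ ger0_norm ?invr_ge0 //.
by rewrite ler_pdivrMl // mulrC.
Qed.

Lemma opnorm_le (A : boundedOp) (M : R) :
  (forall y, `|y| <= 1 -> `|A y| <= M%:C) -> opnorm A <= M.
Proof.
move=> hM; apply: ge_sup; first exact: (opnorm_has_sup A).1.
by move=> _ [y y1 <-]; rewrite -lecR ReK //; exact: hM.
Qed.

Let opnormD (A B : boundedOp) :
  (opnorm (A + B))%:C <= (opnorm A)%:C + (opnorm B)%:C.
Proof.
rewrite -rmorphD lecR; apply: opnorm_le => y y1.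
rewrite (le_trans (ler_normD _ _)) // rmorphD lerD //.
- by rewrite (le_trans (opnormP A y)) // ler_piMr // lecR opnorm_ge0.
- by rewrite (le_trans (opnormP B y)) // ler_piMr // lecR opnorm_ge0.
Qed.

Let opnormZ_le (k : R[i]) (A : boundedOp) :
  (opnorm (k *: A))%:C <= `|k| * (opnorm A)%:C.
Proof.
have kE := ReK (normr_ge0 k); rewrite -kE -rmorphM lecR.
apply: opnorm_le => y y1; rewrite [X in `|X|](_ : _ = k *: A y) // normrZ.
rewrite [leRHS](_ : _ = `|k| * (opnorm A)%:C); last by rewrite -[in RHS]kE -rmorphM.
rewrite ler_wpM2l // (le_trans (opnormP A y)) //.
by rewrite ler_piMr // lecR opnorm_ge0.
Qed.

Let opnormZ (k : R[i]) (A : boundedOp) :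
  (opnorm (k *: A))%:C = `|k| * (opnorm A)%:C.
Proof.
apply/le_anti; rewrite opnormZ_le /=.
have [->|k0] := eqVneq k 0; first by rewrite normr0 mul0r lecR opnorm_ge0.
rewrite -ler_pdivlMl ?normr_gt0 // -normfV.
by rewrite -[in leLHS](scalerK k0 A) opnormZ_le.
Qed.

Let opnorm0 (A : boundedOp) : (opnorm A)%:C = 0 -> A = 0.
Proof.
move=> A0; apply/val_inj/funext => y; apply/eqP; rewrite -normr_le0.
by rewrite (le_trans (opnormP A y)) // A0 mul0r.
Qed.

HB.instance Definition _ :=
  Lmodule_isNormed.Build R[i] boundedOp opnormD opnormZ opnorm0.

End BoundedOperators.

Definition generalized_scalar (R : realType) (Y : normedModType R[i])
    (S : boundedOp Y) : Prop :=
  exists F : {lrmorphism Cinfty R -> boundedOp Y},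
    continuous F /\ F (Cinfty_z R) = S.

(* The algebraic spectrum. On a Banach space, for bounded [T], the inverse is
   automatically bounded and this is the usual spectrum. *)
Definition spectrum (R : realType) (V : lmodType R[i]) (T : V -> V) :
    set R[i] :=
  [set l | ~ bijective (fun v => T v - l *: v)].

(* Main.v *)
Require Import Defs.
From mathcomp Require Import all_boot all_order all_algebra.
From mathcomp Require Import all_classical all_reals all_analysis.
From mathcomp.real_closed Require Import complex.
From mathcomp Require Import ring lra.

Set Implicit Arguments.
Unset Strict Implicit.
Unset Printing Implicit Defensive.

Import Order.TTheory GRing.Theory Num.Theory.
Import numFieldNormedType.Exports.

Local Open Scope classical_set_scope.
Local Open Scope ring_scope.
Local Open Scope complex_scope.

(** Let [F] be a continuous functional calculus with [F z = S], let [y] be in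
    the range of [Phi], and let [Q] be a closed square around a point [z0] off
    the closure of [spectrum T], so small that [T - p] is bijective for all [p]
    in [Q].  Pulling [y] back through [T - p] and pushing forward by [Phi] shows
    that [y] lies in the range of [(S - p) ^ m] for all [p] in [Q] and all [m]
    ([range_divisible_at]).

    The heart of the proof ([calculus_divisible_eq0]) is that such a [y] is
    killed by [F f] for the smooth [f] supported in [Q].  This is a bisection in
    the manner of Goursat.  If [F f y <> 0], a smooth partition of unity writes
    [f] as a sum of four functions supported in overlapping squares of side 2/3
    of the original one, and one of the four pieces retains a quarter of the
    norm.  Iterating gives functions [f_k] supported in nested squares [Q_k] of
    side [l_k = (2/3)^k l_0], with [|F f_k y| >= c / 4^k] and with derivatives of
    order [j] bounded by [D^k M (3/l_k)^j].  The squares shrink to a point [p] of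
    [Q].  By divisibility [y = F ((z - p)^m) u], so [F f_k y] is
    [F (f_k (z - p)^m) u], where [z - p] has size [O(l_k)] on the support of
    [f_k].  Continuity of [F] only costs finitely many, say [n], derivatives,
    hence [|F f_k y| <= A (D (3/2)^n (2/3)^m)^k].  Since [m] may be chosen after
    [D] and [n], this contradicts the lower bound.

    Only the existence of [u] at the single point [p] is used, so no uniformity
    in [p] of the solutions of [(S - p)^m u = y] is required.

    As [Phi] has dense range, [F B = 0] for a bump function [B] supported in [Q]
    with [B z0 = 1].  The function [|z - z0|^2 + B^2] vanishes nowhere, thus has
    a smooth inverse, and [F] maps it to [F (z - z0)] times an operator commuting
    with it.  So [S - z0] is invertible ([support_avoids_spectrum]). *)

(** * A smooth step on the real line *)

Section FlatFunction.
Variable R : realType.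
Implicit Types (t : R) (k : nat).

(** [t^-k exp (-1/t)], extended by 0.  Indexing by [k] makes the family
    stable under derivation up to linear combinations. *)
Definition flat k t : R := if 0 < t then t^-1 ^+ k * expR (- t^-1) else 0.

Lemma flat_ge0 k t : 0 <= flat k t.
Proof.
rewrite /flat; case: ifP => // t0.
by rewrite mulr_ge0 ?expR_ge0 // exprn_ge0 // invr_ge0 ltW.
Qed.

(** The exponential series dominates its term of degree [k + 1]; this is the
    flatness that makes all derivatives at 0 vanish. *)
Lemma flat_le k t : 0 < t -> flat k t <= k.+1`!%:R * t.
Proof.
move=> t0; rewrite /flat t0 expRN ler_pdivrMr ?expR_gt0 //.
have t1 : 0 <= t^-1 by rewrite invr_ge0 ltW.
have f0 : 0 < k.+1`!%:R :> R by rewrite ltr0n fact_gt0.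
apply: (@le_trans _ _ (k.+1`!%:R * t * (t^-1 ^+ k.+1 / k.+1`!%:R))).
  rewrite exprS.
  have -> : k.+1`!%:R * t * (t^-1 * t^-1 ^+ k / k.+1`!%:R) = t^-1 ^+ k :> R.
    by field; rewrite ?gt_eqF.
  by [].
rewrite ler_pM2l ?mulr_gt0 //.
by apply: le_trans (expR_ge1Dxn k t1); rewrite lerDr.
Qed.

Lemma flat_is_derive k t :
  is_derive t 1 (flat k) (flat k.+2 t - k%:R * flat k.+1 t).
Proof.
have [t0|t0|->] := ltgtP t 0.
- rewrite /flat ltNge (ltW t0) /= mulr0 subr0.
  apply: (@near_eq_is_derive _ _ _ (cst 0)).
  near=> s; rewrite /= ltNge ltW //; near: s.
  exact: lt_nbhsl.
- have flatE j : flat j t = t^-1 ^+ j * expR (- t^-1) by rewrite /flat t0.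
  rewrite !flatE.
  pose f := ((fun s : R => s^-1) ^+ k * (fun s : R => expR (- s^-1))).
  apply: (@near_eq_is_derive _ _ _ f); rewrite {}/f.
    by near=> s; rewrite /flat !fctE ifT //; near: s; exact: lt_nbhsr.
  have tn : t != 0 by rewrite gt_eqF.
  have dV : is_derive t 1 (fun s : R => s^-1) (- t ^- 2).
    by have := is_deriveV (f := id) tn (is_derive_id t 1);
      rewrite /GRing.scale /= mulr1.
  have dE : is_derive t 1 (fun s : R => expR (- s^-1)) (expR (- t^-1) * t ^- 2).
    have dN : is_derive t 1 (fun s : R => - s^-1) (t ^- 2).
      by have := is_deriveN dV; rewrite opprK.
    exact: (@is_derive1_comp _ expR _ t _ _ (is_derive_expR _) dN).
  have dX := is_deriveX k dV.
  have D := is_deriveM dX dE.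
  refine (@is_derive_eq _ _ _ _ _ _ _ _ D _).
  rewrite /GRing.scale /= !fctE.
  case: k {dX D} => [|k].
    by rewrite /= expr0 !exprS expr0; set E := expR _; field; rewrite tn.
  rewrite /= !exprS; set E := expR _; set X := t^-1 ^+ k; field.
  by rewrite tn.
- rewrite /flat ltxx mulr0 subr0.
  have cv : (fun h => h^-1 *: (flat k (h *: 1 + 0) - flat k 0)) @ (0 : R)^'
      --> (0 : R).
    apply/cvgr0Pnorm_le => e e0; near=> h.
    rewrite addr0 /GRing.scale /= mulr1 {2}/flat ltxx subr0.
    have hn : h != 0 by near: h; exact: nbhs_dnbhs_neq.
    have [h0|h0] := ltP 0 h; last first.
      by rewrite /flat ltNge h0 /= mulr0 normr0 ltW.
    have -> : h^-1 * flat k h = flat k.+1 h by rewrite /flat h0 exprS mulrA.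
    rewrite ger0_norm ?flat_ge0 // (le_trans (flat_le _ h0)) //.
    rewrite -ler_pdivlMl ?ltr0n ?fact_gt0 // ltW // -(ger0_norm (ltW h0)).
    near: h; apply: dnbhs0_lt.
    by rewrite mulr_gt0 ?invr_gt0 ?ltr0n ?fact_gt0.
  by apply: DeriveDef; [apply/cvg_ex; exists 0|exact: cvg_lim].
Unshelve. all: by end_near. Qed.

End FlatFunction.

Section SmoothStep.
Variable R : realType.
Implicit Types (u : R -> R) (t : R) (n k : nat).

Definition smooth1 u := forall n t, derivable (derive1n n u) t 1.

(** Smoothness is coinductive: any class of functions stable under derivation
    consists of smooth functions. *)
Lemma smooth1_derive_closed (A : set (R -> R)) :
  (forall u, A u -> exists2 v, A v & forall t, is_derive t 1 u (v t)) ->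
  forall u, A u -> smooth1 u.
Proof.
move=> Ad u Au n; suff : A (derive1n n u) by move=> /Ad[v _ uv] t; have [] := uv t.
elim: n => // n /Ad[v Av uv]; rewrite derive1nS.
suff -> : derive1 (derive1n n u) = v by [].
by apply/funext => t; rewrite derive1E; have [_ ->] := uv t.
Qed.

(** An algebra stable under derivation that contains [step]; the compositions
    are with [c - flat 0], as in the definition of [step]. *)
Inductive step_alg : (R -> R) -> Prop :=
| step_alg_cst c : step_alg (cst c)
| step_alg_flat k : step_alg (flat k)
| step_alg_comp k c : step_alg (flat k \o (cst c - flat 0))
| step_algD u v : step_alg u -> step_alg v -> step_alg (u + v)
| step_algM u v : step_alg u -> step_alg v -> step_alg (u * v).

Let dflat k : R -> R := flat k.+2 - cst k%:R * flat k.+1.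

Let step_alg_dflat k : step_alg (dflat k).
Proof.
rewrite /dflat (_ : _ - _ = flat k.+2 + cst (- k%:R) * flat k.+1); last first.
  by apply/funext => t; rewrite !fctE mulNr.
apply: step_algD; first exact: step_alg_flat.
by apply: step_algM; [exact: step_alg_cst|exact: step_alg_flat].
Qed.

Let step_alg_dflat_comp k c : step_alg (dflat k \o (cst c - flat 0)).
Proof.
rewrite (_ : _ \o _ = (flat k.+2 \o (cst c - flat 0)) +
    cst (- k%:R) * (flat k.+1 \o (cst c - flat 0))); last first.
  by apply/funext => t; rewrite /dflat /= !fctE mulNr.
apply: step_algD; first exact: step_alg_comp.
by apply: step_algM; [exact: step_alg_cst|exact: step_alg_comp].
Qed.

Lemma step_alg_smooth u : step_alg u -> smooth1 u.
Proof.
apply: smooth1_derive_closed => {u} u; elim=> {u}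
  [c|k|k c|u v _ [u' au' du] _ [v' av' dv]|u v au [u' au' du] av [v' av' dv]].
- by exists (cst 0); [exact: step_alg_cst|move=> t; exact: is_derive_cst].
- by exists (dflat k); [exact: step_alg_dflat|move=> t; exact: flat_is_derive].
- exists ((dflat k \o (cst c - flat 0)) * (cst (-1) * dflat 0)).
    apply: step_algM; first exact: step_alg_dflat_comp.
    by apply: step_algM; [exact: step_alg_cst|exact: step_alg_dflat].
  move=> t; rewrite 3!fctE; apply: is_derive1_comp.
    exact: flat_is_derive.
  have := is_deriveB (is_derive_cst c t 1) (flat_is_derive 0 t).
  by rewrite mulN1r sub0r.
- exists (u' + v'); first exact: step_algD.
  by move=> t; exact: is_deriveD.
- exists (u * v' + v * u').
    by apply: step_algD; exact: step_algM.
  by move=> t; exact: is_deriveM.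
Qed.

(** Equal to 1 for [t <= 0], where [flat 0 t] vanishes, and to 0 for [1 <= t],
    where [flat 0 t] has reached [exp (-1) = flat 0 1].  Composing [flat 0] with
    itself avoids the quotient of the usual construction. *)
Definition step t : R := flat 0 (expR (-1) - flat 0 t) / flat 0 (expR (-1) : R).

Lemma step_smooth : smooth1 step.
Proof.
apply: step_alg_smooth.
rewrite (_ : step = (flat 0 \o (cst (expR (-1)) - flat 0)) *
                    cst (flat 0 (expR (-1)))^-1) //.
by apply: step_algM; [exact: step_alg_comp|exact: step_alg_cst].
Qed.

Let flat0_gt0 t : 0 < t -> 0 < flat 0 t.
Proof. by move=> t0; rewrite /flat t0 mul1r expR_gt0. Qed.

Lemma step_le0 t : t <= 0 -> step t = 1.
Proof.
move=> t0; rewrite /step [flat 0 t]/flat ltNge t0 subr0 divff //.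
by rewrite gt_eqF ?flat0_gt0 ?expR_gt0.
Qed.

Lemma step_ge1 t : 1 <= t -> step t = 0.
Proof.
move=> t1; have t0 : 0 < t by rewrite (lt_le_trans _ t1).
rewrite /step {1}/flat ifF ?mul0r //; apply/negbTE.
rewrite -leNgt subr_le0 /flat t0 mul1r ler_expR lerN2.
by rewrite invf_le1.
Qed.

Lemma derive1n_locally_cst u c (A : set R) n t :
  open A -> (forall s, A s -> u s = c) -> A t -> derive1n n.+1 u t = 0.
Proof.
move=> oA uc; elim: n t => [|n IHn] t At; rewrite derive1nS derive1E.
  rewrite (near_eq_derive (g := cst c)) ?derive_cst //.
  near=> s; rewrite /= uc //; near: s; exact: open_nbhs_nbhs.
rewrite (near_eq_derive (g := cst 0)) ?derive_cst //.
near=> s; rewrite IHn //; near: s; exact: open_nbhs_nbhs.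
Unshelve. all: by end_near. Qed.

Lemma step_derive_gt1 n t : 1 < t -> derive1n n step t = 0.
Proof.
case: n => [|n] t1; first by rewrite derive1n0 step_ge1 ?ltW.
apply: (@derive1n_locally_cst _ 0 [set s | 1 < s]) => //.
by move=> s /= s1; rewrite step_ge1 ?ltW.
Qed.

Lemma step_derive_lt0 n t : t < 0 -> derive1n n.+1 step t = 0.
Proof.
move=> t0; apply: (@derive1n_locally_cst _ 1 [set s | s < 0]) => //.
by move=> s /= s0; rewrite step_le0 ?ltW.
Qed.

Lemma step_derive_bounded n :
  exists N, forall j, (j <= n)%N -> forall t, `|derive1n j step t| <= N.
Proof.
suff : forall j, exists N, forall t, `|derive1n j step t| <= N.
  move=> /choice[N hN]; exists (\sum_(j < n.+1) N j) => j jn t.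
  rewrite (le_trans (hN j t)) // (bigD1 (Ordinal (jn : (j < n.+1)%N))) //= lerDl.
  by apply: sumr_ge0 => i _; rewrite (le_trans (normr_ge0 (derive1n i step 0))).
move=> j; have cj : continuous (fun t => `|derive1n j step t|).
  move=> t; apply: continuous_comp; last exact: norm_continuous.
  by apply/differentiable_continuous/derivable1_diffP; exact: step_smooth.
have [//|t0 _ h0] := @EVT_max R (fun t => `|derive1n j step t|) 0 1 ler01 _.
  exact: continuous_subspaceT.
exists (1 + `|derive1n j step t0|) => t; have [t1|t1] := ltP 1 t.
  by rewrite step_derive_gt1 // normr0 addr_ge0.
have [t2|t2] := ltP t 0; last first.
  by rewrite (le_trans (h0 t _)) ?in_itv /= ?t1 ?t2 // lerDr.
case: j {cj h0} => [|j].
  by rewrite derive1n0 (step_le0 (ltW t2)) normr1 lerDl.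
by rewrite step_derive_lt0 // normr0 addr_ge0.
Qed.

End SmoothStep.

(** * Partial derivatives and their bounds *)

Section PlaneFunctions.
Variable R : realType.
Implicit Types (f g : R * R -> R[i]) (u : R -> R) (b : bool) (s : seq bool).
Implicit Types (p : R * R) (L M a t : R) (n : nat).

(** The analogue of [smooth1_derive_closed] in the plane. *)
Lemma smooth_partial_closed (A : set (R * R -> R[i])) :
  (forall f, A f -> [/\ continuous f, forall b, has_partial b f &
                        forall b, A (partial b f)]) ->
  forall f, A f -> smooth f.
Proof.
move=> Ad f Af s; suff /Ad[] : A (partials s f) by [].
by elim: s => //= b s /Ad[].
Qed.

Lemma smoothM f g : smooth f -> smooth g -> smooth (f * g).
Proof.
by move=> sf sg; apply/smooth_alg_is_smooth/smooth_algM; exact: smooth_alg_smooth.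
Qed.

Lemma smooth_cst c : smooth (cst c : R * R -> R[i]).
Proof. by apply/smooth_alg_is_smooth; exact: smooth_alg_cst. Qed.

Lemma partials_rcons s b f : partials (rcons s b) f = partials s (partial b f).
Proof. by rewrite /partials foldr_rcons. Qed.

Lemma partialsD s f g : smooth f -> smooth g ->
  partials s (f + g) = partials s f + partials s g.
Proof.
move=> sf sg; elim: s => //= b s ->.
by apply: partialD; [exact: (sf s).2|exact: (sg s).2].
Qed.

Lemma partials_cst s c :
  partials s (cst c) = cst (if s is [::] then c else 0) :> (R * R -> R[i]).
Proof. by elim: s => //= b s ->; rewrite partial_cst. Qed.

Lemma partials_cst0 s : partials s (cst 0) = cst 0 :> (R * R -> R[i]).
Proof. by rewrite partials_cst; case: s. Qed.

Lemma partials_rconsM s b f g p : smooth f -> smooth g ->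
  partials (rcons s b) (f * g) p =
  partials s (partial b f * g) p + partials s (f * partial b g) p.
Proof.
move=> sf sg; rewrite partials_rcons partialM; first last.
- exact: (sg [::]).2.
- exact: (sf [::]).2.
by rewrite partialsD //; apply: smoothM => //; exact: smooth_partial.
Qed.

(** A pointwise substitute for lying outside the support: by the Leibniz rule it
    is inherited by products. *)
Definition vanishes f p := forall s, partials s f p = 0.

Lemma vanishesM f g p : smooth f -> smooth g -> vanishes f p ->
  vanishes (f * g) p.
Proof.
move=> sf sg fp s; elim/last_ind: s f g sf sg fp => [|s b IHs] f g sf sg fp.
  by have /= f0 := fp [::]; rewrite /= fctE f0 mul0r.
rewrite partials_rconsM // !IHs ?addr0 //; first exact: smooth_partial.
  exact: smooth_partial.
by move=> s'; rewrite -partials_rcons fp.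
Qed.

(** Bounds adapted to the scale [1 / L].  At a fixed scale they are stable under
    products up to the constant [2 ^+ n], so that a product of [k] functions with
    comparable bounds at increasing [L] is only exponentially large in [k]. *)
Definition deriv_bound n L M f p :=
  forall s, (size s <= n)%N -> `|partials s f p| <= (M * L ^+ size s)%:C.

Lemma deriv_bound_ge0 n L M f p : deriv_bound n L M f p -> 0 <= M.
Proof.
move=> /(_ [::] (leq0n n)) /=; rewrite mulr1 => fM.
by rewrite -lecR; exact: le_trans (normr_ge0 _) fM.
Qed.

Lemma deriv_bound_partial n L M f p b : deriv_bound n.+1 L M f p ->
  deriv_bound n L (M * L) (partial b f) p.
Proof.
move=> fM s sn; rewrite -partials_rcons.
by have := fM (rcons s b); rewrite size_rcons exprS mulrA; apply.
Qed.

Lemma deriv_bound_leq n m L M f p : (m <= n)%N ->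
  deriv_bound n L M f p -> deriv_bound m L M f p.
Proof. by move=> mn fM s sm; apply: fM; exact: leq_trans sm mn. Qed.

Lemma deriv_bound_le n L L' M M' f p : 0 <= L <= L' -> M <= M' ->
  deriv_bound n L M f p -> deriv_bound n L' M' f p.
Proof.
move=> /andP[L0 LL] MM fM s sn; rewrite (le_trans (fM s sn)) // lecR.
rewrite ler_pM //; first exact: (deriv_bound_ge0 fM).
  by rewrite exprn_ge0.
by rewrite lerXn2r // nnegrE (le_trans L0).
Qed.

Lemma deriv_boundM n L M M' f g p : 0 <= L -> smooth f -> smooth g ->
  deriv_bound n L M f p -> deriv_bound n L M' g p ->
  deriv_bound n L (2 ^+ n * (M * M')) (f * g) p.
Proof.
move=> L0; elim: n M M' f g => [|n IHn] M M' f g sf sg fM gM s.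
  rewrite leqn0 size_eq0 => /eqP -> /=; rewrite expr0 mul1r mulr1 fctE normrM.
  rewrite rmorphM /= ler_pM //.
    by have := fM [::] isT; rewrite /= mulr1.
  by have := gM [::] isT; rewrite /= mulr1.
have M0 := deriv_bound_ge0 fM; have M'0 := deriv_bound_ge0 gM.
case/lastP: s => [|s b] sn /=.
  rewrite mulr1 fctE normrM; apply: (@le_trans _ _ (M * M')%:C).
    rewrite rmorphM /= ler_pM //.
      by have := fM [::] isT; rewrite /= mulr1.
    by have := gM [::] isT; rewrite /= mulr1.
  by rewrite lecR ler_peMl ?mulr_ge0 // exprn_ege1 // ler1n.
rewrite size_rcons ltnS in sn.
rewrite partials_rconsM // (le_trans (ler_normD _ _)) //.
have h1 := IHn _ _ _ _ (smooth_partial b sf) sg (deriv_bound_partial b fM)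
  (deriv_bound_leq (leqnSn n) gM) s sn.
have h2 := IHn _ _ _ _ sf (smooth_partial b sg)
  (deriv_bound_leq (leqnSn n) fM) (deriv_bound_partial b gM) s sn.
rewrite (le_trans (lerD h1 h2)) // -rmorphD lecR size_rcons !exprS.
by rewrite le_eqVlt; apply/orP; left; apply/eqP; ring.
Qed.

Lemma deriv_boundX n L M f p m : 0 <= L -> smooth f -> deriv_bound n L M f p ->
  smooth (f ^+ m) /\ deriv_bound n L ((2 ^+ n * M) ^+ m) (f ^+ m) p.
Proof.
move=> L0 sf fM; elim: m => [|m [sm IHm]].
  rewrite !expr0; split; first exact: smooth_cst.
  move=> s _; rewrite (partials_cst s 1); case: s => [|b s] /=.
    by rewrite mulr1 normr1.
  by rewrite normr0 mul1r lecR exprn_ge0.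
split; first by rewrite exprS; exact: smoothM.
by rewrite !exprS -mulrA; exact: deriv_boundM.
Qed.

Definition pcoord b p := if b then p.2 else p.1.
Definition pull b u : R * R -> R[i] := fun p => (u (pcoord b p))%:C.

Lemma pcoord_axis b b' h p :
  pcoord b (h *: axis R b' + p) = (if b == b' then h else 0) + pcoord b p.
Proof.
by case: b b' => -[] /=; rewrite /GRing.scale /= ?mulr1 ?mulr0.
Qed.

Lemma pull_is_derive b b' u p : derivable u (pcoord b p) 1 ->
  is_derive p (axis R b') (fun q => u (pcoord b q))
    (if b == b' then derive1 u (pcoord b p) else 0).
Proof.
move=> du; have [bb|bb] := eqVneq b b'.
  rewrite derive1E.
  have dE : (fun h => h^-1 *: (((fun q => u (pcoord b q)) \o shift p)
        (h *: axis R b') - u (pcoord b p))) =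
      (fun h => h^-1 *: ((u \o shift (pcoord b p)) (h *: 1) - u (pcoord b p))).
    by apply/funext => h; rewrite /= pcoord_axis bb eqxx /GRing.scale /= mulr1.
  by apply: DeriveDef; rewrite /derivable /derive dE.
have dE : (fun h => h^-1 *: (((fun q => u (pcoord b q)) \o shift p)
      (h *: axis R b') - u (pcoord b p))) = cst 0.
  by apply/funext => h; rewrite /= pcoord_axis (negbTE bb) add0r subrr scaler0.
apply: DeriveDef; rewrite /derivable /derive dE; first exact: is_cvg_cst.
by apply: cvg_lim => //; exact: cvg_cst.
Qed.

Lemma pull_has_partial b b' u : (forall t, derivable u t 1) ->
  has_partial b' (pull b u).
Proof.
move=> du p; split; last exact: derivable_cst.
by have [] := pull_is_derive b' (du (pcoord b p)).
Qed.

Lemma partial_pull b b' u : (forall t, derivable u t 1) ->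
  partial b' (pull b u) = if b == b' then pull b (derive1 u) else cst 0.
Proof.
move=> du; apply/funext => p; rewrite /partial /pull /= derive_cst.
by have [_ ->] := pull_is_derive b' (du (pcoord b p)); case: ifP.
Qed.

Lemma continuous_pull b u : continuous u -> continuous (pull b u).
Proof.
move=> cu p; rewrite (_ : pull b u = @coord_z R \o (fun q => (u (pcoord b q), 0))) //.
apply: continuous_comp; last exact: continuous_z.
have c1 : (fun q => u (pcoord b q)) @ p --> u (pcoord b p).
  apply: (@continuous_comp _ _ _ (pcoord b) u); last exact: cu.
  by case: b; [exact: cvg_snd|exact: cvg_fst].
exact: (cvg_pair c1 (cvg_cst (0 : R))).
Qed.

Lemma smooth1_derivable u : smooth1 u -> forall t, derivable u t 1.
Proof. by move=> su; exact: (su 0%N). Qed.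

Lemma smooth1_derive1 u : smooth1 u -> smooth1 (derive1 u).
Proof. by move=> su n; rewrite -derive1Sn; exact: su. Qed.

Lemma smooth1_cst c : smooth1 (cst c : R -> R).
Proof. by apply: step_alg_smooth; exact: step_alg_cst. Qed.

Lemma smooth_pull b u : smooth1 u -> smooth (pull b u).
Proof.
move=> su; apply: (@smooth_partial_closed
  [set f | exists2 v, smooth1 v & f = pull b v]).
  move=> _ [v sv ->]; have dv := smooth1_derivable sv; split=> [|b'|b'].
  - apply: continuous_pull => t.
    exact/differentiable_continuous/derivable1_diffP/dv.
  - exact: pull_has_partial.
  - rewrite /= partial_pull //; case: ifP => _.
      by exists (derive1 v) => //; exact: smooth1_derive1.
    by exists (cst 0) => //; exact: smooth1_cst.
by exists u.
Qed.

(** A function of one coordinate only has derivatives in the direction of that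
    coordinate. *)
Lemma partials_pull s b u p : smooth1 u -> partials s (pull b u) p =
  if all (pred1 b) s then (derive1n (size s) u (pcoord b p))%:C else 0.
Proof.
elim/last_ind: s u => [|s b' IHs] u su //.
rewrite partials_rcons partial_pull; last exact: smooth1_derivable.
rewrite all_rcons size_rcons /= [b' == b]eq_sym; case: eqP => [_|_] /=.
  by rewrite IHs -?derive1Sn //; exact: smooth1_derive1.
by rewrite partials_cst0.
Qed.

Lemma affine_is_derive u L a t : derivable u (L * (t - a)) 1 ->
  is_derive t 1 (fun r => u (L * (r - a))) (derive1 u (L * (t - a)) * L).
Proof.
move=> /derivableP; rewrite -derive1E => du.
have da : is_derive t 1 (fun r => L * (r - a)) L.
  have := is_deriveZ L (is_deriveB (is_derive_id t (1 : R)) (is_derive_cst a t 1)).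
  by rewrite subr0 /GRing.scale /= mulr1.
exact: (@is_derive1_comp _ u (fun r => L * (r - a))).
Qed.

Lemma derive1n_affine u L a n : smooth1 u ->
  derive1n n (fun t => u (L * (t - a))) =
  (fun t => derive1n n u (L * (t - a)) * L ^+ n).
Proof.
move=> su; elim: n => [|n IHn]; first by apply/funext => t /=; rewrite mulr1.
rewrite derive1nS IHn; apply/funext => t; rewrite derive1E.
have D := affine_is_derive (su n (L * (t - a))).
rewrite (_ : (fun _ => _) = (L ^+ n) *: (fun r => derive1n n u (L * (r - a)))); last first.
  by apply/funext => r; rewrite /GRing.scale /= mulrC.
have [_ ->] := is_deriveZ (L ^+ n) D.
by rewrite /GRing.scale /= exprSr; ring.
Qed.

Lemma smooth1_affine u L a : smooth1 u -> smooth1 (fun t => u (L * (t - a))).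
Proof.
move=> su n t; rewrite derive1n_affine //.
have [D _] := affine_is_derive (su n (L * (t - a))).
rewrite (_ : (fun _ => _) = (L ^+ n) *: (fun r => derive1n n u (L * (r - a)))); last first.
  by apply/funext => r; rewrite /GRing.scale /= mulrC.
exact: derivableZ.
Qed.

End PlaneFunctions.

(** * Smooth partitions of unity along the axes *)

Section Cuts.
Variable R : realType.
Implicit Types (f g : R * R -> R[i]) (u : R -> R) (b e : bool) (s : seq bool).
Implicit Types (p : R * R) (L M a t : R) (n : nat).

Lemma smoothN f : smooth f -> smooth (- f).
Proof.
move=> sf; rewrite (_ : - f = cst (-1) * f); first exact/smoothM/sf/smooth_cst.
by apply/funext => p; rewrite !fctE mulN1r.
Qed.

Lemma partialsN s f : smooth f -> partials s (- f) = - partials s f.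
Proof.
move=> sf; apply/eqP; rewrite -addr_eq0 addrC -partialsD //; last exact: smoothN.
by rewrite subrr; apply/eqP; exact: partials_cst0.
Qed.

Lemma deriv_boundD n L M M' f g p : smooth f -> smooth g ->
  deriv_bound n L M f p -> deriv_bound n L M' g p ->
  deriv_bound n L (M + M') (f + g) p.
Proof.
move=> sf sg fM gM s sn; rewrite partialsD // mulrDl rmorphD.
by rewrite (le_trans (ler_normD _ _)) // lerD ?fM ?gM.
Qed.

Lemma deriv_boundN n L M f p : smooth f ->
  deriv_bound n L M f p -> deriv_bound n L M (- f) p.
Proof. by move=> sf fM s sn; rewrite partialsN // fctE normrN fM. Qed.

Lemma deriv_bound_cst n L M (c : R[i]) p : 0 <= L -> `|c| <= M%:C ->
  deriv_bound n L M (cst c) p.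
Proof.
move=> L0 cM [|b s] _; rewrite partials_cst /=; first by rewrite mulr1.
rewrite normr0 lecR mulr_ge0 ?exprn_ge0 //.
by rewrite -lecR; exact: le_trans (normr_ge0 _) cM.
Qed.

Lemma normc_le_add (x y : R) : `|x +i* y| <= (`|x| + `|y|)%:C.
Proof.
have -> : x +i* y = x%:C + 'i%C * y%:C by simpc.
rewrite (le_trans (ler_normD _ _)) // rmorphD normrM !normc_def /= .
by rewrite !expr0n !expr1n !(addr0, add0r) sqrtr1 mul1r !sqrtr_sqr.
Qed.

Lemma smooth_mem f : smooth f -> f \in @smoothb R.
Proof. by move=> sf; apply/asboolP. Qed.

Lemma smooth_step b L a : smooth (pull b (fun t => step (L * (t - a)))).
Proof. exact/smooth_pull/smooth1_affine/step_smooth. Qed.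

Definition descent b L a : Cinfty R := MkCinfty (smooth_mem (smooth_step b L a)).

(** The two members of a partition of unity along one coordinate: the transition
    takes place between [a] and [a + L^-1], and [cut true] is the member that
    lives on the upper side. *)
Definition cut e b L a : Cinfty R :=
  if e then 1 - descent b L a else descent b L a.

Lemma cut_sum b L a : cut false b L a + cut true b L a = 1.
Proof. by rewrite /cut addrC subrK. Qed.

Lemma cut_deriv_bound n : exists N : R, forall e b L a p, 0 <= L ->
  deriv_bound n L N (cut e b L a) p.
Proof.
have [N hN] := step_derive_bounded R n.
have bd b L a p : 0 <= L -> deriv_bound n L N (descent b L a) p.
  move=> L0 s sn; rewrite partials_pull; last exact/smooth1_affine/step_smooth.
  have N0 : 0 <= N by rewrite (le_trans _ (hN 0%N _ 0)).
  case: ifP => _; last by rewrite normr0 lecR mulr_ge0 ?exprn_ge0.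
  rewrite derive1n_affine; last exact: step_smooth.
  rewrite normc_def /= expr0n addr0 sqrtr_sqr lecR normrM.
  by rewrite ler_pM // ?hN // ger0_norm ?exprn_ge0.
exists (1 + N) => e b L a p L0.
have N0 := deriv_bound_ge0 (bd b L a p L0).
case: e; last by apply: deriv_bound_le (bd b L a p L0); rewrite ?L0 ?lexx ?lerDr.
apply: deriv_boundD; [exact: smooth_cst|exact/smoothN/smooth_step| |].
  by apply: deriv_bound_cst => //; rewrite normr1.
by apply: deriv_boundN; [exact: smooth_step|exact: bd].
Qed.

Lemma cut_lo_vanishes b L a p : 0 < L -> a + L^-1 < pcoord b p ->
  vanishes (cut false b L a) p.
Proof.
move=> L0 ap s; rewrite partials_pull; last exact/smooth1_affine/step_smooth.
case: ifP => // _; rewrite derive1n_affine; last exact: step_smooth.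
rewrite step_derive_gt1 ?mul0r // mulrC -ltr_pdivrMr // div1r.
by rewrite ltrBrDl.
Qed.

Lemma cut_hi_vanishes b L a p : 0 < L -> pcoord b p < a ->
  vanishes (cut true b L a) p.
Proof.
move=> L0 ap s.
have neg : L * (pcoord b p - a) < 0 by rewrite pmulr_rlt0 // subr_lt0.
rewrite (_ : partials s _ = partials s (cst 1 - descent b L a)) //.
rewrite partialsD; [|exact: smooth_cst|exact/smoothN/smooth_step].
rewrite partialsN; last exact: smooth_step.
rewrite partials_cst !fctE partials_pull; last exact/smooth1_affine/step_smooth.
case: s => [|b' s]; first by rewrite /= step_le0 ?subrr // ltW.
case: ifP => _; last by rewrite subr0.
rewrite derive1n_affine; last exact: step_smooth.
by rewrite [size _]/= step_derive_lt0 // mul0r subr0.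
Qed.

(** On a square of side [l] containing [q], the function [z - q] is [O(l)] at the
    scale [l], which makes its [m]-th power [O(l^m)] by [deriv_boundX]. *)
Lemma deriv_bound_z n (l : R) (p q : R * R) : 0 < l ->
  (forall b, `|pcoord b p - pcoord b q| <= l) ->
  deriv_bound n (3 / l) (2 * l) (@coord_z R - cst (coord_z q)) p.
Proof.
move=> l0 pq s _; have sz : smooth (@coord_z R) := Cinfty_smooth (Cinfty_z R).
rewrite partialsD //; last exact/smoothN/smooth_cst.
rewrite partialsN; last exact: smooth_cst.
rewrite partials_cst !fctE; case/lastP: s => [|s b] /=.
  have -> : coord_z p - coord_z q = (p.1 - q.1) +i* (p.2 - q.2) by [].
  rewrite (le_trans (normc_le_add _ _)) // lecR mulr1 mulr2n mulrDl mul1r lerD //.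
    exact: (pq false).
  exact: (pq true).
have -> : (if rcons s b is [::] then coord_z q else 0) = 0 by case: (s).
rewrite subr0 partials_rcons partial_z partials_cst size_rcons.
have c0 : 0 <= 3 / l by rewrite divr_ge0 // ltW.
case: s => [|b' s]; last first.
  by rewrite normr0 lecR mulr_ge0 ?exprn_ge0 // mulr_ge0 // ltW.
have -> : 2 * l * (3 / l) ^+ 1 = 6 by rewrite expr1; field; rewrite gt_eqF.
rewrite (le_trans (normc_le_add _ _)) // lecR.
by case: b; rewrite /= normr0 normr1 ?addr0 ?add0r ler1n.
Qed.

End Cuts.

(** * Two facts on real sequences *)

Section RealLemmas.
Variable R : realType.

Lemma nested_intervals (a l : nat -> R) : (forall k, 0 <= l k) ->
  (forall k, a k <= a k.+1 /\ a k.+1 + l k.+1 <= a k + l k) ->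
  exists x, forall k, a k <= x <= a k + l k.
Proof.
move=> l0 al.
have mono j k : (j <= k)%N -> a j <= a k /\ a k + l k <= a j + l j.
  move=> /subnKC <-; elim: (k - j)%N => [|i [h1 h2]]; first by rewrite addn0.
  have [h3 h4] := al (j + i)%N; rewrite addnS.
  by split; [exact: le_trans h1 h3|exact: le_trans h4 h2].
have ub j k : a j <= a k + l k.
  have [jk|/ltnW kj] := leqP j k.
    by rewrite (le_trans (mono _ _ jk).1) // lerDl.
  by rewrite (le_trans _ (mono _ _ kj).2) // lerDl.
have hs (k : nat) : has_sup (range a).
  by split; [exists (a 0%N), 0%N|exists (a k + l k) => _ [j _ <-]].
exists (sup (range a)) => k; apply/andP; split.
  by apply: ub_le_sup; [exact: (hs k).2|exists k].
by apply: ge_sup; [exact: (hs k).1|move=> _ [j _ <-]].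
Qed.

Lemma geometric_small (r E eps : R) : 0 <= r < 1 -> 0 < eps ->
  exists m, E * r ^+ m <= eps.
Proof.
move=> /andP[r0 r1] e0.
have cv : (fun m => E * r ^+ m) @ \oo --> E * 0.
  by apply: cvgM; [exact: cvg_cst|apply: cvg_expr; rewrite ger0_norm].
rewrite mulr0 in cv.
have /cvgr0Pnorm_le/(_ _ e0)[m _ hm] := cv.
by exists m; rewrite (le_trans (ler_norm _)) // hm /=.
Qed.

End RealLemmas.

(** * Bisection in a functional calculus *)

Section RealNorm.
Variables (R : realType) (Y : normedModType R[i]).
Implicit Types v w : Y.

(** The norm of a complex space takes values in [R[i]]; its real part lives in a
    totally ordered field. *)
Definition rnorm v : R := complex.Re `|v|.

Lemma rnormE v : (rnorm v)%:C = `|v|.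
Proof. by rewrite RRe_real // ger0_real. Qed.

Lemma rnorm_ge0 v : 0 <= rnorm v.
Proof. by rewrite -lecR rnormE; exact: normr_ge0. Qed.

Lemma rnormD v w : rnorm (v + w) <= rnorm v + rnorm w.
Proof. by rewrite -lecR rmorphD /= !rnormE ler_normD. Qed.

Lemma rnorm_eq0 v : rnorm v = 0 -> v = 0.
Proof. by move=> v0; apply/normr0_eq0; rewrite -rnormE v0. Qed.

Lemma rnorm_opnorm (A : boundedOp Y) v : rnorm (A v) <= opnorm A * rnorm v.
Proof. by rewrite -lecR rmorphM /= !rnormE opnormP. Qed.

End RealNorm.

Section FunctionalCalculus.
Variables (R : realType) (Y : normedModType R[i]).
Variable F : {lrmorphism Cinfty R -> boundedOp Y}.

(** A neighbourhood of 0 in the Frechet topology only constrains finitely many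
    derivatives, so a continuous calculus has finite order: this [n] is the loss
    of derivatives that the exponent [m] has to beat later on. *)
Lemma calculus_bound : continuous F -> exists n (C : R), 0 < C /\
  forall (M : R) (f : Cinfty R), 0 < M ->
    (forall s p, (size s <= n)%N -> `|partials s f p| <= M%:C) ->
    opnorm (F f) <= C * M.
Proof.
move=> cF.
have N1 : nbhs (0 : boundedOp Y) [set A | `|A| < 1] 
  by exact: (@nbhs0_lt _ (boundedOp Y) 1 ltr01).
have := cF 0; rewrite /continuous_at linear0 => /(_ _ N1)[[n e] /= e0 hF].
have c0 : 0 < 2 ^+ n * 2 / e :> R by rewrite divr_gt0 ?mulr_gt0 ?exprn_gt0.
exists n, (2 ^+ n * 2 / e); split=> // M f M0 fM.
pose k := (2 ^+ n * 2 / e * M)^-1.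
have k0 : 0 < k by rewrite invr_gt0 mulr_gt0.
have sf := Cinfty_smooth f.
have kf : Cinfty_ball 0 n e (k%:C *: f).
  move=> s p sn _; rewrite subr0.
  have -> : partials s (k%:C *: f : Cinfty R) p = partials s (cst k%:C * f) p by [].
  have fM1 : deriv_bound n 1 M f p by move=> s' sn'; rewrite expr1n mulr1; exact: fM.
  have kb : deriv_bound n 1 k (cst k%:C) p.
    apply: deriv_bound_cst => //.
    by rewrite normc_def /= expr0n addr0 sqrtr_sqr ger0_norm // ltW.
  have := deriv_boundM ler01 (smooth_cst _) sf kb fM1 sn.
  move=> /le_lt_trans; apply; rewrite ltcR expr1n mulr1.
  have -> : 2 ^+ n * (k * M) = e / 2 :> R.
    rewrite /k; field; rewrite !gt_eqF // exprn_gt0 //.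
  by rewrite ltr_pdivrMr // ltr_pMr // ltr1n.
have := hF _ kf; rewrite /= linearZ /= normrZ.
rewrite [X in _ * X < _](_ : _ = (opnorm (F f))%:C) //.
rewrite normc_def /= expr0n addr0 sqrtr_sqr ger0_norm ?(ltW k0) // -rmorphM ltcR.
by rewrite mulrC -ltr_pdivlMr // div1r invrK => /ltW.
Qed.

Variable y : Y.

Lemma rnorm_halving (f : Cinfty R) b (L a c : R) : c <= rnorm (F f y) ->
  exists e, c / 2 <= rnorm (F (f * cut e b L a) y).
Proof.
move=> cf; have fE : f = f * cut false b L a + f * cut true b L a.
  by rewrite -mulrDr cut_sum mulr1.
have [h|h] := leP (c / 2) (rnorm (F (f * cut false b L a) y)).
  by exists false.
exists true; rewrite leNgt; apply/negP => h'.
suff : c < c by rewrite ltxx.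
rewrite {2}[c]splitr; apply: le_lt_trans (ltrD h h').
apply: (le_trans cf); rewrite {1}fE rmorphD; exact: rnormD.
Qed.

Definition in_square (q : bool -> R) (l : R) (p : R * R) :=
  forall b, q b <= pcoord b p <= q b + l.

(** The invariant of the bisection.  The scale [3 / l] is that of the cuts made
    in the middle third of a square of side [l]. *)
Definition concentrated n (q : bool -> R) (l M c : R) (f : Cinfty R) :=
  [/\ forall p, ~ in_square q l p -> vanishes f p,
      forall p, deriv_bound n (3 / l) M f p &
      c <= rnorm (F f y)].

(** Cutting both coordinates in the middle third of the sides leaves four pieces
    supported in squares of side [l * (2 / 3)], and two uses of [rnorm_halving]
    find one that keeps a quarter of [c].  It matters that [D] is independent of
    the square. *)
Lemma bisection n : exists2 D : R, 0 <= D &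
  forall (q : bool -> R) (l M c : R) (f : Cinfty R),
    0 < l -> concentrated n q l M c f ->
    exists (q' : bool -> R) (f' : Cinfty R),
      concentrated n q' (l * (2 / 3)) (D * M) (c / 4) f' /\
      forall b, q b <= q' b /\ q' b + l * (2 / 3) <= q b + l.
Proof.
have [N hN] := cut_deriv_bound R n.
have N0 : 0 <= N.
  exact: (deriv_bound_ge0 (hN false false 0 0 (0, 0) (lexx 0))).
exists (2 ^+ n * (2 ^+ n * (N * N))); first by rewrite !mulr_ge0 // exprn_ge0.
move=> q l M c f l0 [fq fM fc].
have L0 : 0 < 3 / l by rewrite divr_gt0.
have LV : (3 / l)^-1 = l / 3 by field; rewrite gt_eqF.
pose w e b := cut e b (3 / l) (q b + l / 3).
have [e1 h1] := rnorm_halving false (3 / l) (q false + l / 3) fc.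
have [e2 h2] := rnorm_halving true (3 / l) (q true + l / 3) h1.
pose e b := if b then e2 else e1.
exists (fun b => q b + (if e b then l / 3 else 0)), (f * w e1 false * w e2 true).
have sm (g : Cinfty R) : smooth g := Cinfty_smooth g.
have wv b p : ~ (q b + (if e b then l / 3 else 0) <= pcoord b p <=
    q b + (if e b then l / 3 else 0) + l * (2 / 3)) ->
    vanishes f p \/ vanishes (w (e b) b) p.
  move=> /negP; rewrite negb_and -!ltNge => pq.
  have [pf|pf] := boolP (q b <= pcoord b p <= q b + l); last first.
    by left; apply: fq => /(_ b); rewrite (negbTE pf).
  right; case: (e b) pq pf => pq /andP[pf1 pf2].
    apply: cut_hi_vanishes => //; case/orP: pq => // pq.
    by move: pq pf2; lra.
  apply: cut_lo_vanishes => //; rewrite LV; case/orP: pq => // pq.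
    by move: pq pf1; lra.
  by move: pq; lra.
split; last first.
  by move=> b; case: (e b); split; lra.
split.
- move=> p /existsNP[b /wv[fv|wbv]].
    by apply: (vanishesM (sm _) (sm _)); apply: (vanishesM (sm _) (sm _)).
  case: b wbv => wbv.
    by rewrite mulrC; apply: (vanishesM (sm _) (sm _)).
  rewrite [f * _]mulrC.
  by apply: (vanishesM (sm _) (sm _)); apply: (vanishesM (sm _) (sm _)).
- move=> p; have h := deriv_boundM (ltW L0) (sm (f * w e1 false)) (sm (w e2 true))
    (deriv_boundM (ltW L0) (sm f) (sm (w e1 false)) (fM p) (hN _ _ _ _ p (ltW L0)))
    (hN _ _ _ _ p (ltW L0)).
  apply: deriv_bound_le h.
    rewrite ltW //= ler_pM2l // lef_pV2 ?posrE ?mulr_gt0 ?divr_gt0 //.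
    by rewrite ler_piMr ?ltW // ltr_pdivrMr // mul1r ltr_nat.
  by rewrite le_eqVlt; apply/orP; left; apply/eqP; ring.
- by apply: le_trans h2; lra.
Qed.

Lemma iterated_bisection n (q0 : bool -> R) (l0 M0 c : R) (f0 : Cinfty R) :
  0 < l0 -> concentrated n q0 l0 M0 c f0 ->
  exists (D : R) (p : R * R) (q : nat -> bool -> R) (f : nat -> Cinfty R),
  [/\ 0 <= D, forall k, in_square (q k) (l0 * (2 / 3) ^+ k) p, in_square q0 l0 p &
  forall k, concentrated n (q k) (l0 * (2 / 3) ^+ k) (D ^+ k * M0)
    (c / 4 ^+ k) (f k)].
Proof.
move=> l0_gt0 cf0; have [D D0 hD] := bisection n; exists D.
pose l k := l0 * (2 / 3) ^+ k.
have l_gt0 k : 0 < l k by rewrite mulr_gt0 // exprn_gt0 // divr_gt0.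
pose inv k (st : (bool -> R) * Cinfty R) :=
  concentrated n st.1 (l k) (D ^+ k * M0) (c / 4 ^+ k) st.2.
have /choice[g hg] : forall kst : nat * ((bool -> R) * Cinfty R), exists st',
    inv kst.1 kst.2 -> inv kst.1.+1 st' /\
    forall b, kst.2.1 b <= st'.1 b /\
              st'.1 b + l kst.1.+1 <= kst.2.1 b + l kst.1.
  move=> [k [q f]]; have [h|h] := pselect (inv k (q, f)); last by exists (q0, f0).
  have [q' [f' [h1 h2]]] := hD _ _ _ _ _ (l_gt0 k) h.
  exists (q', f') => _; rewrite /inv /=.
  have -> : l k.+1 = l k * (2 / 3) by rewrite /l exprSr -mulrA.
  have -> : D ^+ k.+1 * M0 = D * (D ^+ k * M0) by rewrite exprS mulrA.
  by have -> : c / 4 ^+ k.+1 = c / 4 ^+ k / 4 by rewrite exprSr invfM mulrA.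
pose st := fix st k := if k is k'.+1 then g (k', st k') else (q0, f0).
have invst k : inv k (st k).
  elim: k => [|k IHk]; last by have [] := hg (k, st k) IHk.
  by rewrite /inv /l /st /= !expr0 mulr1 mul1r divr1.
have nest b k : (st k).1 b <= (st k.+1).1 b /\
    (st k.+1).1 b + l k.+1 <= (st k).1 b + l k.
  by have [_] := hg (k, st k) (invst k).
have ex b := nested_intervals (fun k => ltW (l_gt0 k)) (nest b).
have [x hx] := ex false; have [z hz] := ex true.
have sq k : in_square (st k).1 (l k) (x, z) by case; [exact: hz|exact: hx].
exists (x, z), (fun k => (st k).1), (fun k => (st k).2).
split=> //; by have := sq 0%N; rewrite /l expr0 mulr1.
Qed.

(** With [F z = S], this says that [y] is in the range of every power of
    [S - p]. *)
Definition divisible_at p := forall m, exists u,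
  F ((Cinfty_z R - (coord_z p)%:A) ^+ m) u = y.

Lemma Cinfty_expE (g : Cinfty R) m :
  (g ^+ m : Cinfty R) = (g : R * R -> R[i]) ^+ m :> (R * R -> R[i]).
Proof. by elim: m => // m IHm; rewrite !exprS -IHm. Qed.

Lemma Cinfty_zB p : (Cinfty_z R - (coord_z p)%:A : Cinfty R) =
  @coord_z R - cst (coord_z p) :> (R * R -> R[i]).
Proof.
apply/funext => r; transitivity (coord_z r - coord_z p * 1) => //.
by rewrite mulr1.
Qed.

(** On the square both factors are estimated at the scale [3 / l], and off the
    square the product vanishes to infinite order.  The [n] derivatives cost a
    factor [(3 / l) ^+ n], as [l <= 1]. *)
Lemma concentrated_bound n q (l M c : R) (f : Cinfty R) p m : 0 < l <= 1 ->
  0 < M -> concentrated n q l M c f -> in_square q l p ->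
  forall s r, (size s <= n)%N ->
  `|partials s (f * (Cinfty_z R - (coord_z p)%:A) ^+ m : Cinfty R) r| <=
    (2 ^+ n * (M * (2 ^+ n * (2 * l)) ^+ m) * (3 / l) ^+ n)%:C.
Proof.
move=> /andP[l0 l1] M0 [fv fM _] pq s r sn.
have L1 : 1 <= 3 / l by rewrite ler_pdivlMr // mul1r (le_trans l1) // ler1n.
have L0 : 0 <= 3 / l by rewrite (le_trans _ L1).
rewrite -[X in partials s X]/((f : R * R -> R[i]) *
  (((Cinfty_z R - (coord_z p)%:A) ^+ m : Cinfty R) : R * R -> R[i])).
have sz : smooth (@coord_z R - cst (coord_z p)).
  by rewrite -Cinfty_zB; exact: Cinfty_smooth.
rewrite Cinfty_expE Cinfty_zB.
have X0 : 0 <= 2 ^+ n * (M * (2 ^+ n * (2 * l)) ^+ m).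
  by rewrite !mulr_ge0 ?exprn_ge0 ?mulr_ge0 ?exprn_ge0 // ltW.
have [rq|rq] := pselect (in_square q l r); last first.
  rewrite (vanishesM (Cinfty_smooth f) _ (fv r rq)).
    by rewrite normr0 lecR mulr_ge0 // exprn_ge0.
  by rewrite -Cinfty_zB -Cinfty_expE; exact: Cinfty_smooth.
have near_p b : `|pcoord b r - pcoord b p| <= l.
  by have := rq b; have := pq b; rewrite ler_norml; lra.
have [szm zb] := deriv_boundX m L0 sz (deriv_bound_z (n := n) l0 near_p).
have fzb := deriv_boundM L0 (Cinfty_smooth f) szm (fM r) zb.
apply: (le_trans (fzb s sn)).
by rewrite lecR ler_wpM2l // ler_weXn2l.
Qed.

(** The point [p] where the nested squares meet gives the contradiction: there
    [y = F ((z - p)^m) u] with [m] large compared with the order of [F] and with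
    the growth rate [D] of the bisection. *)
Lemma calculus_divisible_eq0 (q0 : bool -> R) (l0 : R) (f0 : Cinfty R) :
  continuous F -> 0 < l0 <= 1 ->
  (forall p, ~ in_square q0 l0 p -> vanishes f0 p) ->
  (forall n, exists M, forall p, deriv_bound n (3 / l0) M f0 p) ->
  (forall p, in_square q0 l0 p -> divisible_at p) ->
  F f0 y = 0.
Proof.
move=> cF /andP[l0_gt0 l0_le1] f0v f0b divp.
have [n [C [C0 hC]]] := calculus_bound cF.
have [M0 fM0] := f0b n.
have [c0|c0] := leP (rnorm (F f0 y)) 0.
  by apply/rnorm_eq0/le_anti; rewrite c0 rnorm_ge0.
have M0_ge0 : 0 <= M0 := deriv_bound_ge0 (fM0 (0, 0)).
have [D [p [q [f [D0 pq pq0 cf]]]]] := iterated_bisection l0_gt0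
  (And3 f0v fM0 (lexx (rnorm (F f0 y)))).
(* 4 is lost in norm at each step, [D] is gained in size, and [(3 / 2) ^+ n] is
   the price of [n] derivatives when the scale shrinks by 2/3. *)
have [||m hm] := @geometric_small R (2 / 3) (4 * (D + 1) * (3 / 2) ^+ n) (1 / 2).
- by rewrite divr_ge0 //= ltr_pdivrMr // mul1r ltr_nat.
- by rewrite divr_gt0.
have [u hu] := divp p pq0 m.
set c := rnorm (F f0 y) in c0 cf.
pose A := C * (2 ^+ n * ((M0 + 1) * (2 ^+ n * (2 * l0)) ^+ m) * (3 / l0) ^+ n) *
  rnorm u.
have decay k : c <= A * (1 / 2) ^+ k.
  pose l := l0 * (2 / 3) ^+ k; pose r : R := 2 / 3.
  have r0 : 0 < r by rewrite divr_gt0.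
  have r1 : r <= 1 by rewrite /r ler_pdivrMr // mul1r ler_nat.
  have l_gt0 : 0 < l by rewrite mulr_gt0 // exprn_gt0.
  have l_le1 : l <= 1.
    by rewrite mulr_ile1 ?exprn_ge0 ?exprn_ile1 ?(ltW r0) ?(ltW l0_gt0).
  (* [D] and [M0] may be 0, while [calculus_bound] asks for positive bounds. *)
  have M_gt0 : 0 < (D + 1) ^+ k * (M0 + 1) by rewrite mulr_gt0 ?exprn_gt0 ?ltr_wpDl.
  have cfk : concentrated n (q k) l ((D + 1) ^+ k * (M0 + 1)) (c / 4 ^+ k) (f k).
    have [fv fM fc] := cf k; split=> // p'; apply: deriv_bound_le (fM p').
      by rewrite lexx divr_ge0 // ltW.
    by rewrite ler_pM ?exprn_ge0 ?lerXn2r ?lerDl ?nnegrE ?addr_ge0.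
  have lk : 0 < l <= 1 by rewrite l_gt0.
  have B := concentrated_bound m lk M_gt0 cfk (pq k).
  have t_gt0 : 0 < 2 ^+ n * (2 * l) by rewrite mulr_gt0 ?exprn_gt0 // mulr_gt0.
  have Mk_gt0 : 0 < 2 ^+ n * ((D + 1) ^+ k * (M0 + 1) * (2 ^+ n * (2 * l)) ^+ m) *
      (3 / l) ^+ n.
    rewrite mulr_gt0 //; last by rewrite exprn_gt0 // divr_gt0.
    by rewrite mulr_gt0 ?exprn_gt0 // mulr_gt0 ?exprn_gt0.
  have opb := hC _ _ Mk_gt0 B.
  have fc : c / 4 ^+ k <= rnorm (F (f k) y) by case: cfk.
  have FE : F (f k) y = F (f k * (Cinfty_z R - (coord_z p)%:A) ^+ m) u.
    by rewrite rmorphM /= hu.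
  rewrite FE in fc.
  have {opb fc} := le_trans fc (le_trans (rnorm_opnorm _ _)
    (ler_wpM2r (rnorm_ge0 _) opb)).
  rewrite ler_pdivrMr ?exprn_gt0 // => /le_trans; apply.
  rewrite [leLHS](_ : _ =
    A * (4 * (D + 1) * (3 / 2) ^+ n * (2 / 3) ^+ m) ^+ k).
    rewrite ler_wpM2l //.
      have t0_ge0 : 0 <= 2 ^+ n * (2 * l0).
        by rewrite mulr_ge0 ?exprn_ge0 // mulr_ge0 // ltW.
      rewrite /A mulr_ge0 ?rnorm_ge0 // mulr_ge0 ?(ltW C0) //.
      rewrite mulr_ge0 ?exprn_ge0 ?divr_ge0 ?(ltW l0_gt0) //.
      by rewrite mulr_ge0 ?exprn_ge0 // mulr_ge0 ?exprn_ge0 ?addr_ge0.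
    by rewrite lerXn2r // nnegrE !mulr_ge0 ?exprn_ge0 ?divr_ge0 ?addr_ge0.
  have -> : 3 / l = 3 / l0 * (3 / 2) ^+ k.
    by rewrite /l exprMn exprVn exprMn exprVn; field; rewrite ?expf_neq0 ?gt_eqF.
  have -> : 2 ^+ n * (2 * l) = 2 ^+ n * (2 * l0) * r ^+ k by rewrite /l /r; ring.
  rewrite /A !exprMn -!exprM ![(k * _)%N]mulnC /r; ring.
have [k hk] := @geometric_small R (1 / 2) A (c / 2) ltac:(lra) ltac:(lra).
by have := le_trans (decay k) hk; rewrite leNgt ltr_pdivrMr // ltr_pMr // ltr1n.
Qed.

End FunctionalCalculus.

(** * Bump functions and smooth inverses *)

Section Bump.
Variable R : realType.
Implicit Types (q : bool -> R) (l : R).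

(** Rises in the first third of [[q b, q b + l]] and falls in the last third. *)
Definition bump_factor q l b : Cinfty R :=
  cut true b (3 / l) (q b) * cut false b (3 / l) (q b + l * (2 / 3)).

Definition bump q l : Cinfty R := bump_factor q l false * bump_factor q l true.

Lemma bump_vanishes q l p : 0 < l -> ~ in_square q l p -> vanishes (bump q l) p.
Proof.
move=> l0; have L0 : 0 < 3 / l by rewrite divr_gt0.
have LV : (3 / l)^-1 = l / 3 by field; rewrite gt_eqF.
have sm (g : Cinfty R) : smooth g := Cinfty_smooth g.
have fv b : ~ (q b <= pcoord b p <= q b + l) -> vanishes (bump_factor q l b) p.
  move=> /negP; rewrite negb_and -!ltNge => /orP[pq|pq].
    by apply: (vanishesM (sm _) (sm _)); exact: cut_hi_vanishes.
  rewrite /bump_factor mulrC; apply: (vanishesM (sm _) (sm _)).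
  by apply: cut_lo_vanishes => //; rewrite LV; move: pq; lra.
move=> /existsNP[[] /fv fp].
  by rewrite /bump mulrC; apply: (vanishesM (sm _) (sm _)).
by apply: (vanishesM (sm _) (sm _)).
Qed.

Lemma bump_deriv_bound q l n : 0 < l ->
  exists M, forall p, deriv_bound n (3 / l) M (bump q l) p.
Proof.
move=> l0; have L0 : 0 <= 3 / l by rewrite divr_ge0 // ltW.
have [N hN] := cut_deriv_bound R n.
have sm (g : Cinfty R) : smooth g := Cinfty_smooth g.
exists (2 ^+ n * ((2 ^+ n * (N * N)) * (2 ^+ n * (N * N)))) => p.
have factor b := deriv_boundM L0 (sm _) (sm _) (hN true b (3 / l) (q b) p L0)
  (hN false b (3 / l) (q b + l * (2 / 3)) p L0).
exact: (deriv_boundM L0 (sm (bump_factor q l false)) (sm (bump_factor q l true))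
  (factor false) (factor true)).
Qed.

Lemma bump_real q l p : exists r : R, bump q l p = r%:C.
Proof.
have cut_real e b L a : exists r : R, cut e b L a p = r%:C.
  case: e; last by exists (step (L * (pcoord b p - a))).
  exists (1 - step (L * (pcoord b p - a))); by rewrite rmorphB.
have [r1 h1] := cut_real true false (3 / l) (q false).
have [r2 h2] := cut_real false false (3 / l) (q false + l * (2 / 3)).
have [r3 h3] := cut_real true true (3 / l) (q true).
have [r4 h4] := cut_real false true (3 / l) (q true + l * (2 / 3)).
exists (r1 * r2 * (r3 * r4)); rewrite !rmorphM /= -h1 -h2 -h3 -h4.
by [].
Qed.

Lemma bump_center q l p : 0 < l -> (forall b, pcoord b p = q b + l / 2) ->
  bump q l p = 1.
Proof.
move=> l0 pq.
have hi b : cut true b (3 / l) (q b) p = 1.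
  transitivity (1 - (step (3 / l * (pcoord b p - q b)))%:C) => //.
  rewrite step_ge1 ?subr0 // pq.
  by rewrite (_ : _ * _ = 3 / 2); [lra|field; rewrite gt_eqF].
have lo b : cut false b (3 / l) (q b + l * (2 / 3)) p = 1.
  transitivity ((step (3 / l * (pcoord b p - (q b + l * (2 / 3)))))%:C) => //.
  rewrite step_le0 // pq.
  by rewrite (_ : _ * _ = - (1 / 2)); [lra|field; rewrite gt_eqF].
transitivity ((cut true false (3 / l) (q false) p *
  cut false false (3 / l) (q false + l * (2 / 3)) p) *
  (cut true true (3 / l) (q true) p *
  cut false true (3 / l) (q true + l * (2 / 3)) p)) => //.
by rewrite !hi !lo !mulr1.
Qed.

End Bump.

Section Inverse.
Variable R : realType.

Lemma smooth1_id : smooth1 (@id R).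
Proof.
apply: (@smooth1_derive_closed _
  [set u | u = id \/ exists c, u = cst c]); last by left.
move=> u [->|[c ->]].
  by exists (cst 1); [right; exists 1|move=> t; exact: is_derive_id].
by exists (cst 0); [right; exists 0|move=> t; exact: is_derive_cst].
Qed.

Lemma smooth_affine b (a : R) : smooth (pull b (fun t => 1 * (t - a))).
Proof. exact/smooth_pull/(@smooth1_affine _ id)/smooth1_id. Qed.

Definition affine b a : Cinfty R := MkCinfty (smooth_mem (smooth_affine b a)).

Variables (G : Cinfty R) (r : R * R -> R).
Hypothesis Gr : forall p, G p = (r p)%:C.
Hypothesis r0 : forall p, r p != 0.

Let h : R * R -> R[i] := fun p => ((r p)^-1)%:C.

(** The inverse [h] has derivative [- G' h^2], so adjoining it to the smooth
    functions gives an algebra that is stable under derivation. *)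
Inductive recip_alg : (R * R -> R[i]) -> Prop :=
| recip_alg_smooth f : smooth f -> recip_alg f
| recip_alg_inv : recip_alg h
| recip_algD f g : recip_alg f -> recip_alg g -> recip_alg (f + g)
| recip_algM f g : recip_alg f -> recip_alg g -> recip_alg (f * g).

Let r_derivable b p : derivable r p (axis R b).
Proof.
have [+ _] := (Cinfty_smooth G [::]).2 b p.
by rewrite (_ : (fun q => _) = r) //; apply/funext => q /=; rewrite Gr.
Qed.

Let partial_h b : partial b h = - (partial b G) * (h * h).
Proof.
apply/funext => p; rewrite /partial !fctE /h /= derive_cst.
rewrite (deriveV (r0 p) (@r_derivable b p)).
rewrite (_ : (fun q => complex.Re (G q)) = r); last by apply/funext => q; rewrite Gr.
rewrite (_ : (fun q => complex.Im (G q)) = cst 0); last by apply/funext => q; rewrite Gr.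
rewrite derive_cst; apply/eqP; rewrite eq_complex /= /GRing.scale /=.
by apply/andP; split; apply/eqP; rewrite ?expr2 ?invfM; ring.
Qed.

Lemma smooth_recip : smooth h.
Proof.
apply: (@smooth_partial_closed _ recip_alg); last exact: recip_alg_inv.
move=> f; elim=> {f}
  [f sf||f g _ [cf pf af] _ [cg pg ag]|f g sf [cf pf af] sg [cg pg ag]].
- split; [exact: (sf [::]).1|exact: (sf [::]).2|move=> b].
  by apply: recip_alg_smooth; exact: smooth_partial.
- split.
  + move=> p; have hE : h = (fun q => (G q)^-1).
      by apply/funext => q; rewrite Gr /h fmorphV.
    rewrite hE; apply: cvgV; last exact: (Cinfty_smooth G [::]).1.
    by rewrite Gr fmorph_eq0.
  + move=> b p; split; last exact: derivable_cst.
    exact: (derivableV (r0 p) (@r_derivable b p)).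
  + move=> b; rewrite partial_h; apply: recip_algM.
      exact/recip_alg_smooth/smoothN/smooth_partial/Cinfty_smooth.
    by apply: recip_algM; exact: recip_alg_inv.
- split=> [x|b|b]; [exact: (cvgD (cf x) (cg x))|exact: has_partialD|].
  by rewrite partialD //; exact: recip_algD.
- split=> [x|b|b]; [exact: (cvgM (cf x) (cg x))|exact: has_partialM|].
  rewrite (partialM (pf b) (pg b)).
  exact: (recip_algD (recip_algM (af b) sg) (recip_algM sf (ag b))).
Qed.

Lemma Cinfty_unit : exists H : Cinfty R, G * H = 1.
Proof.
exists (MkCinfty (smooth_mem smooth_recip)); apply/val_inj/funext => p.
transitivity (G p * h p) => //.
by rewrite Gr /h -rmorphM /= divff.
Qed.

End Inverse.

(** Let [z0] be the centre of the square.  Adding the square of the bump [B] to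
    [|z - z0|^2] removes the zero at [z0] and, as [F B = 0], does not change the
    image under [F]; so the smooth inverse of the sum yields an inverse of
    [F (z - z0)].  [B] is squared because it is real and its square is
    nonnegative. *)
Lemma support_avoids_spectrum (R : realType) (Y : normedModType R[i])
    (F : {lrmorphism Cinfty R -> boundedOp Y}) (q : bool -> R) (l : R)
    (z0 : R * R) : 0 < l -> (forall b, pcoord b z0 = q b + l / 2) ->
  F (bump q l) = 0 -> ~ spectrum (F (Cinfty_z R)) (coord_z z0).
Proof.
move=> l0 zq; set B := bump q l => FB; apply.
pose X := affine false z0.1; pose Z := affine true z0.2.
pose w : Cinfty R := Cinfty_z R - (coord_z z0)%:A.
(* The complex conjugate of [w]. *)
pose w' : Cinfty R := X - 'i%C *: Z.
have wE : w * w' = X * X + Z * Z.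
  apply/val_inj/funext => p.
  transitivity ((coord_z p - coord_z z0 * 1) *
    ((1 * (p.1 - z0.1))%:C - 'i%C * (1 * (p.2 - z0.2))%:C)) => //.
  transitivity ((1 * (p.1 - z0.1))%:C * (1 * (p.1 - z0.1))%:C +
    (1 * (p.2 - z0.2))%:C * (1 * (p.2 - z0.2))%:C); last by [].
  rewrite /coord_z; apply/eqP; rewrite eq_complex /=.
  by apply/andP; split; apply/eqP; ring.
have /choice[r Br] : forall p, exists r : R, B p = r%:C := bump_real q l.
have [||H GH] := @Cinfty_unit R (X * X + Z * Z + B * B)
    (fun p => (p.1 - z0.1) ^+ 2 + (p.2 - z0.2) ^+ 2 + r p ^+ 2).
- move=> p; transitivity ((1 * (p.1 - z0.1))%:C * (1 * (p.1 - z0.1))%:C +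
    (1 * (p.2 - z0.2))%:C * (1 * (p.2 - z0.2))%:C + B p * B p) => //.
  by rewrite Br -!rmorphM -!rmorphD /= !mul1r !expr2.
- move=> p; apply/eqP => G0.
  have [s1 s2] := (sqr_ge0 (p.1 - z0.1), sqr_ge0 (p.2 - z0.2)).
  have s3 := sqr_ge0 (r p).
  have e1 : (p.1 - z0.1) ^+ 2 = 0 by lra.
  have e2 : (p.2 - z0.2) ^+ 2 = 0 by lra.
  have e3 : r p ^+ 2 = 0 by lra.
  move/eqP: e1; rewrite sqrf_eq0 subr_eq0 => /eqP e1.
  move/eqP: e2; rewrite sqrf_eq0 subr_eq0 => /eqP e2.
  have pz : p = z0 by rewrite [p]surjective_pairing [z0]surjective_pairing e1 e2.
  have := Br p; rewrite pz (bump_center l0 zq) => /eqP.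
  move/eqP: e3; rewrite sqrf_eq0 pz => /eqP ->.
  by rewrite oner_eq0.
have wV : F w * F (w' * H) = 1.
  have BH : F (B * B * H) = 0.
    by move: B FB {Br GH} => B FB; rewrite !rmorphM /= FB !mul0r.
  transitivity (F (w * w' * H) + F (B * B * H)).
    by rewrite BH addr0 -mulrA -rmorphM.
  by rewrite -rmorphD wE -mulrDl GH rmorph1.
have Vw : F (w' * H) * F w = 1 by rewrite -rmorphM mulrC rmorphM.
have wS : F w = (fun v => F (Cinfty_z R) v - coord_z z0 *: v) :> (Y -> Y).
  by apply/funext => v; rewrite rmorphB /= linearZ /= rmorph1.
rewrite /= -wS; exists (F (w' * H)) => v.
  by have /(congr1 (fun A : boundedOp Y => A v)) := Vw.
by have /(congr1 (fun A : boundedOp Y => A v)) := wV.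
Qed.

(** * Transfer along the intertwining map *)

(** If [V] inverts [T - p], then [Phi (V^m x)] solves the equation for
    [y = Phi x]. *)
Lemma range_divisible_at (R : realType) (X : lmodType R[i])
    (Y : normedModType R[i]) (Phi : {linear X -> Y}) (T : {linear X -> X})
    (F : {lrmorphism Cinfty R -> boundedOp Y}) p :
  Phi \o T = F (Cinfty_z R) \o Phi -> ~ spectrum T (coord_z p) ->
  forall x, divisible_at F (Phi x) p.
Proof.
move=> PT /contrapT [V _ TV] x m.
suff [w <-] : exists w, F ((Cinfty_z R - (coord_z p)%:A) ^+ m) (Phi w) = Phi x.
  by exists (Phi w).
elim: m x => [|m IHm] x; first by exists x; rewrite expr0 rmorph1.
have [w hw] := IHm (V x).
exists w; rewrite exprS rmorphM /= hw rmorphB /= linearZ /= rmorph1.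
transitivity ((F (Cinfty_z R) \o Phi) (V x) - coord_z p *: Phi (V x)) => //.
by rewrite -PT /= -linearZ -linearB TV.
Qed.

Lemma boundedOp_dense_eq0 (R : realType) (Y : normedModType R[i])
    (A : boundedOp Y) (D : set Y) : dense D -> (forall y, D y -> A y = 0) -> A = 0.
Proof.
move=> Dd AD; apply/val_inj/funext => y; apply/eqP/negPn/negP => Ay.
have [||v [/= Av /AD]] := Dd (A @^-1` [set z | z != 0]).
- by exists y.
- apply: open_comp => [v _|]; first exact: boundedOp_continuous.
  rewrite (_ : mkset _ = ~` [set 0]); last by apply/seteqP; split => z /eqP.
  rewrite openC; apply: accessible_closed_set1.
  exact/hausdorff_accessible/norm_hausdorff.
- by apply/eqP.
Qed.

Theorem theorem2p1 (R : realType) (X Y : completeNormedModType R[i])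
    (Phi : {linear X -> Y}) (Phi_dense : dense (range Phi))
    (T : {linear X -> X}) (S : boundedOp Y) (S_gs : generalized_scalar S)
    (PhiT_SPhi : Phi \o T = S \o Phi) :
  spectrum S `<=` closure (spectrum T).
Proof.
case: S_gs PhiT_SPhi => F [cF <-] PT [a b] specS; apply: contrapT.
move=> /existsNP[B /not_implyP[Bn /set0P/negP/negPn/eqP BT]].
have /nbhs_ballP[e /= e0 eB] := Bn.
have eE : e = (complex.Re e)%:C by rewrite RRe_real // gtr0_real.
pose r := complex.Re e.
have r0 : 0 < r by rewrite -ltcR -eE.
pose l := Num.min 1 (r / 2).
have l0 : 0 < l by rewrite lt_min ltr01 divr_gt0.
have l1 : l <= 1 by rewrite ge_min lexx.
have lr : l < r.
  by rewrite gt_min ltr_pdivrMr // ltr_pMr // ltr1n orbT.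
pose q (c : bool) := pcoord c (a, b) - l / 2.
(* A point of the square is within [l / 2 + l / 2 < r] of its centre. *)
have resolvent p : in_square q l p -> ~ spectrum T (coord_z p).
  move=> pq Tp; suff : (spectrum T `&` B) (coord_z p) by rewrite BT.
  split=> //; apply: eB; rewrite -ball_normE /=.
  rewrite (_ : a +i* b - coord_z p = (a - p.1) +i* (b - p.2)) //.
  rewrite (le_lt_trans (normc_le_add _ _)) // eE ltcR (le_lt_trans _ lr) //.
  have := pq false; have := pq true; rewrite /q /= => h1 h2.
  rewrite [leRHS]splitr lerD // ler_norml; [move: h2|move: h1]; lra.
move: specS; apply: (@support_avoids_spectrum _ _ F q l (a, b)) => //.
  by move=> c; rewrite /q subrK.
apply: (boundedOp_dense_eq0 Phi_dense) => _ [x _ <-].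
apply: (calculus_divisible_eq0 cF (q0 := q) (l0 := l)).
- by rewrite l0.
- by move=> p; exact: bump_vanishes.
- by move=> n; exact: bump_deriv_bound.
- by move=> p /resolvent Tp; exact: (range_divisible_at PT Tp).
Qed.
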